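(* Let $m,n$ be integers with $m+n\ge 0$. The number of $K$-paths from $(-2m,-2m)$ to $(2n,2n)$ is $a_{m+n}$.
   Context: $a_k=\frac1{2k+1}\binom{3k}{k}$. Paths are finite sequences of points (vertices) of $\mathbb Z^2$; steps are differences of consecutive vertices. A normal path has steps $(1,0),(0,1)$; an $H_2$-path has steps $(2,0),(0,1)$; a $V_2$-path has steps $(1,0),(0,2)$. A $K$-path is a path $P$ such that: (1) $P$ never goes above the diagonal (all vertices satisfy $y\le x$); (2) the part of $P$ below the line $y=-2x$ is a $V_2$-path; (3) the part of $P$ between the lines $y=-2x$ and $x=-2y$ is a normal path; (4) the part of $P$ above the line $x=-2y$ is an $H_2$-path. Thus $P$ is a $V_2$-path followed by a normal path followed by an $H_2$-path (some possibly empty), consecutive parts meeting at a vertex on the separating line. Precisely, all vertices satisfy $y\le x$, and each step from a vertex $(x,y)$ satisfies: if $y<-2x$, the step is $(1,0)$ or $(0,2)$ and its endpoint $(x',y')$ has $y'\le -2x'$; if $y\ge -2x$ and $x<-2y$, the step is $(1,0)$ or $(0,1)$ and its endpoint has $x'\le -2y'$; if $x\ge -2y$, the step is $(2,0)$ or $(0,1)$. *)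

(* Defs.v *)
From mathcomp Require Import all_boot all_order all_algebra.
From mathcomp Require Import finmap.
From mathcomp Require Import boolp classical_sets functions cardinality.

Set Implicit Arguments.
Unset Strict Implicit.
Unset Printing Implicit Defensive.

Import Order.TTheory GRing.Theory Num.Theory.

Local Open Scope ring_scope.

Definition a (k : nat) : rat := 'C(3 * k, k)%:R / (2 * k + 1)%:R.

Definition Z2 : Type := (int * int)%type.

Definition normal_steps : seq Z2 := [:: (1, 0); (0, 1)].
Definition H2_steps : seq Z2 := [:: (2, 0); (0, 1)].
Definition V2_steps : seq Z2 := [:: (1, 0); (0, 2)].

(* On points with y <= x the three premises are mutually exclusive and
   exhaustive, so exactly one clause governs each step of a K-path. *)
Definition K_step (p q : Z2) : bool :=
  [&& (p.2 < - (2 * p.1)) ==>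
        ((q - p \in V2_steps) && (q.2 <= - (2 * q.1))),
      ((- (2 * p.1) <= p.2) && (p.1 < - (2 * p.2))) ==>
        ((q - p \in normal_steps) && (q.1 <= - (2 * q.2)))
    & (- (2 * p.2) <= p.1) ==> (q - p \in H2_steps)].

Definition K_path (P : seq Z2) : bool :=
  all (fun p : Z2 => p.2 <= p.1) P && sorted K_step P.

(* A path is its nonempty list of vertices, so the path of length zero at u
   is [:: u]. *)
Definition K_paths (u v : Z2) : set (seq Z2) :=
  [set P | exists s : seq Z2, [/\ P = u :: s, last u s = v & K_path P]]%classic.

(* Main.v *)
Require Import Defs.
From mathcomp Require Import all_boot all_order all_algebra.
From mathcomp Require Import finmap.
From mathcomp Require Import boolp classical_sets functions cardinality.
From mathcomp Require Import zify.

Set Implicit Arguments.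
Unset Strict Implicit.
Unset Printing Implicit Defensive.

Import Order.TTheory GRing.Theory Num.Theory.

Local Open Scope ring_scope.

(** The count is exact because the part of a K-path after the line y = -2x can
    be traded for a V2-path: from a point (i, -2i) of that line with i >= 0,
    there are as many ways to reach (2n, 2n), n >= 0, by a normal path followed
    by an H2-path as by a V2-path that stays weakly below the diagonal. Once
    this is known, for m, n >= 0 the K-paths from (-2m, -2m) to (2n, 2n) are
    equinumerous with V2-paths between the same points, whose number depends on
    m + n only; when m <= 0 or n <= 0 the K-path is a single H2- or V2-path
    anyway.

    In terms of the height e = x - y relative to the diagonal, an H2-path is a walk
    with steps +2, -1 and a V2-path a walk with steps +1, -2, both on the
    nonnegative integers and ending at height 0 after a number of steps which
    the starting point determines ([hwalks], [vwalks]). The normal part is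
    described by its distance d = -(x + 2y) to the line where H2-steps begin
    and its distance c = 2x + y from the line where V2-steps end: a step lowers
    d by 1 and raises c by 2, or lowers d by 2 and raises c by 1. Continuing it
    by an arbitrary weight f of the arrival height gives [crossing f d c], and
    on the line y = -2x one has c = 0 and d = e. The exchange is then
    [crossing_hwalks]: as a function of e, crossing (hwalks k) e 0 satisfies
    the recursion of vwalks k e in k.

    The reason is that crossing does not see translations of c. If c > 0 the
    last phase never starts at height 0, so a step +2, -1 may be taken before
    the normal part instead of after it. At c = 0, with d = e >= 2, taking a
    normal step first makes c positive; pushing the H2-step through then leaves
    four terms, of which three regroup as crossing at e + 1 and the last one is
    crossing at e - 2.

    Taking e = 0 also shows that hwalks k 0 = vwalks k 0, and for k = 3n this
    is the ternary Catalan number by the ballot formula [hwalks_bin]. The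
    lemmas [counts_H2], [counts_normal] and [counts_V2] evaluate the number of
    K-paths from every relevant point, each region feeding the next one. *)

(** * One-dimensional walks *)

Section Walks.
Local Open Scope nat_scope.

(** Walks from e to 0 in k steps that stay nonnegative, with steps +2, -1. *)
Fixpoint hwalks (k e : nat) : nat :=
  if k is k'.+1 then
    hwalks k' e.+2 + (if e is e'.+1 then hwalks k' e' else 0)
  else e == 0.

(** As for [hwalks], with steps +1, -2. *)
Fixpoint vwalks (k e : nat) : nat :=
  if k is k'.+1 then
    vwalks k' e.+1 + (if e is e'.+2 then vwalks k' e' else 0)
  else e == 0.

(** Normal paths that start at distances d and c from the two separating lines
    and end on the line d = 0, each weighted by f at its final value of c. The
    nested match forbids the double step at d = 1, where it would jump over
    that line. *)
Fixpoint crossing (f : nat -> nat) (d c : nat) : nat :=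
  if d is d1.+1 then
    crossing f d1 c.+2 + (if d1 is d2.+1 then crossing f d2 c.+1 else 0)
  else f c.

Lemma nat_ind2 (P : nat -> Prop) :
  P 0 -> P 1 -> (forall d, P d -> P d.+1 -> P d.+2) -> forall d, P d.
Proof.
move=> P0 P1 IH d; suff [] : P d /\ P d.+1 by [].
by elim: d => [//|d [Pd PSd]]; split=> //; apply: IH.
Qed.

Lemma crossingSS f d c :
  crossing f d.+2 c = crossing f d.+1 c.+2 + crossing f d c.+1.
Proof. by []. Qed.

(** The recursion of [hwalks] commutes with [crossing] away from c = 0, since
    the boundary term of [hwalks] at height 0 is never met: c only grows. *)
Lemma crossing_hwalks_interior k d c :
  crossing (hwalks k.+1) d c.+1
  = crossing (hwalks k) d c.+3 + crossing (hwalks k) d c.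
Proof.
move: c; elim/nat_ind2: d => [c|c| d IH0 IH1 c] //; first by rewrite /= !addn0.
by rewrite !crossingSS IH0 IH1; lia.
Qed.

(** The exchange principle: on the line y = -2x, continuing by a normal path and
    then an H2-path is as good as continuing by a V2-path. One normal step
    leads into the interior, where the recursion of [hwalks] passes through
    [crossing]. *)
Lemma crossing_hwalks k e : crossing (hwalks k) e 0 = vwalks k e.
Proof.
elim: k e => [|k IHk] e.
  suff H : forall c, crossing (hwalks 0) e c = ((e == 0) && (c == 0)).
    by rewrite H andbT.
  elim/nat_ind2: e => [c|c| d IH0 IH1 c] //.
  by rewrite crossingSS IH1 IH0 !andbF.
case: e => [|[|e]]; rewrite [vwalks _ _]/= -!IHk.
- by rewrite /= !addn0.
- by rewrite /= !addn0.
- by rewrite crossingSS !crossing_hwalks_interior; rewrite !crossingSS; lia.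
Qed.

Lemma hwalks0_vwalks0 k : hwalks k 0 = vwalks k 0.
Proof. by rewrite -crossing_hwalks. Qed.

Lemma hwalks_small k e : k < e -> hwalks k e = 0.
Proof.
elim: k e => [|k IHk] [|e] //= lt_ke.
by rewrite !IHk //; lia.
Qed.

(** Ballot formula. A walk from e to 0 of length e + 3u has u up-steps and
    v = e + 2u down-steps, and the number of good walks is C(k, v) minus twice
    C(k, u - 1). Writing the latter as C(k, v + 1) keeps the formula valid for
    u = 0. Both sides obey the Pascal recursion; at height 0, where the
    down-step is missing, it still holds because C(k, 2u - 1) = 2 C(k, 2u) for
    k = 3u - 1. *)
Lemma hwalks_bin k e u : k = e + 3 * u ->
  hwalks k e + 2 * 'C(k, (e + 2 * u).+1) = 'C(k, e + 2 * u).
Proof.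
elim: k e u => [|k IHk] e u def_k.
  by have [-> ->] : e = 0 /\ u = 0 by lia.
have up : hwalks k e.+2 + 2 * 'C(k, (e + 2 * u).+1) = 'C(k, e + 2 * u).
  case: u def_k => [|u] def_k.
    by rewrite hwalks_small ?bin_small //; lia.
  have -> : e + 2 * u.+1 = e.+2 + 2 * u by lia.
  by apply: IHk; lia.
rewrite [hwalks _ _]/=; case: e def_k up => [|e] def_k up.
  have [v def_v] : exists v, 2 * u = v.+1 by exists (2 * u).-1; lia.
  rewrite !add0n def_v !binS in up *.
  have eq2 : 'C(k, v) = 2 * 'C(k, v.+1).
    have u_gt0 : 0 < u by lia.
    have := mul_bin_left k v; have -> : k - v = u by lia.
    by rewrite -{1}def_v => E; apply/eqP; rewrite -(eqn_pmul2l u_gt0) -E; lia.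
  lia.
have down := IHk e u ltac:(lia).
rewrite addSn !binS in up *; lia.
Qed.

Lemma hwalks_ternary_catalan n : (2 * n).+1 * hwalks (3 * n) 0 = 'C(3 * n, n).
Proof.
have := @hwalks_bin (3 * n) 0 n erefl; rewrite add0n => E.
have := mul_bin_left (3 * n) (2 * n).
have -> : 3 * n - 2 * n = n by lia.
have -> : 'C(3 * n, n) = 'C(3 * n, 2 * n).
  by rewrite -bin_sub; [congr 'C(_, _)|]; lia.
nia.
Qed.

End Walks.

(** * Counting K-paths with a fixed target *)

(** The lists s are the paths without their first vertex p, so that prepending
    a step is a plain cons. *)
Definition counts (t p : Z2) (N : nat) : Prop :=
  exists L : seq (seq Z2), [/\ uniq L, size L = N &
    forall s, (s \in L) = K_path (p :: s) && (last p s == t)].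

Lemma K_path_cons p q s : p.2 <= p.1 ->
  K_path (p :: q :: s) = (q.2 <= q.1) && K_step p q && K_path (q :: s).
Proof.
rewrite /K_path /= => ->.
by case: (q.2 <= q.1); case: (K_step p q); rewrite //= ?andbF.
Qed.

Lemma K_stepE (x y x' y' : int) : y <= x ->
  K_step (x, y) (x', y') =
  if y < - (2 * x) then
    ((x' == x + 1) && (y' == y) || (x' == x) && (y' == y + 2))
    && (y' <= - (2 * x'))
  else if x < - (2 * y) then
    ((x' == x + 1) && (y' == y) || (x' == x) && (y' == y + 1))
    && (x' <= - (2 * y'))
  else (x' == x + 2) && (y' == y) || (x' == x) && (y' == y + 1).
Proof.
move=> le_yx.
have -> : K_step (x, y) (x', y') =
  [&& (y < - (2 * x)) ==>
        (((x' - x, y' - y) \in V2_steps) && (y' <= - (2 * x'))),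
      ((- (2 * x) <= y) && (x < - (2 * y))) ==>
        (((x' - x, y' - y) \in normal_steps) && (x' <= - (2 * y')))
    & (- (2 * y) <= x) ==> ((x' - x, y' - y) \in H2_steps)] by [].
rewrite !inE !xpair_eqE.
case: ifP => [|]; [|case: ifP]; lia.
Qed.

(** Both coordinates are nondecreasing and their sum strictly increases, which
    prevents a path from returning to its target or from overshooting it. *)
Lemma K_path_mono p s : K_path (p :: s) ->
  p.1 <= (last p s).1 /\ p.1 + p.2 + (size s)%:Z <= (last p s).1 + (last p s).2.
Proof.
elim: s p => [|q s IHs] p; first by move=> _ /=; lia.
move=> Pps; have le_p : p.2 <= p.1 by case/andP: Pps => /andP[].
move: Pps; rewrite K_path_cons // => /andP[/andP[_ pq] /IHs] /=.
case: p q pq le_p {IHs} => [x y] [x' y'] /= pq le_p; move: pq.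
rewrite K_stepE //; set u := (last _ _).1; set v := (last _ _).2.
by case: ifP => [|]; [|case: ifP]; lia.
Qed.

Lemma counts_target (t : Z2) : t.2 <= t.1 -> counts t t 1.
Proof.
move=> le_t; exists [:: [::]]; split=> // s; rewrite inE.
apply/eqP/idP => [->|/andP[Ps /eqP last_s]]; first by rewrite /K_path /= le_t eqxx.
by have [_] := K_path_mono Ps; rewrite last_s; case: s {Ps last_s} => //= *; lia.
Qed.

Lemma counts_past (t p : Z2) : t.1 < p.1 -> counts t p 0.
Proof.
move=> lt_tp; exists [::]; split=> // s; rewrite in_nil.
apply/esym/negP => /andP[Ps /eqP last_s].
by have [] := K_path_mono Ps; rewrite last_s; lia.
Qed.

(** First-step decomposition; the booleans tell which of the two candidate
    steps is legal at p. *)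
Lemma counts_step (t p q1 q2 : Z2) (b1 b2 : bool) N1 N2 :
  p.2 <= p.1 -> p != t -> q1 != q2 ->
  (forall q, (q.2 <= q.1) && K_step p q = b1 && (q == q1) || b2 && (q == q2)) ->
  (b1 -> counts t q1 N1) -> (b2 -> counts t q2 N2) ->
  counts t p ((if b1 then N1 else 0) + (if b2 then N2 else 0))%N.
Proof.
move=> le_p neq_pt neq_q step_p c1 c2.
have branch q (b : bool) N : (b -> counts t q N) ->
    exists L : seq (seq Z2), [/\ uniq L, size L = (if b then N else 0)%N &
      forall s, (s \in L) = b && (K_path (q :: s) && (last q s == t))].
  by case: b => [/(_ isT)//|_]; exists [::]; split.
have [L1 [uL1 <- L1E]] := branch _ _ _ c1.
have [L2 [uL2 <- L2E]] := branch _ _ _ c2.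
have cons_inj q : injective (cons q : seq Z2 -> _) by move=> s s' [].
exists (map (cons q1) L1 ++ map (cons q2) L2); split.
- rewrite cat_uniq !map_inj_uniq // uL1 uL2 andbT /=.
  apply/hasPn => _ /mapP[s _ ->]; apply/mapP => -[s' _ [eq_q _]].
  by rewrite eq_q eqxx in neq_q.
- by rewrite size_cat !size_map.
have mem_cons q q' (s : seq Z2) L :
    (q :: s \in map (cons q') L) = (q == q') && (s \in L).
  apply/mapP/andP => [[s' ? [-> ->]]|[/eqP-> ?]]; [by rewrite eqxx | by exists s].
case=> [|q s].
  rewrite /= (negPf neq_pt) andbF mem_cat.
  by apply/negP => /orP[] /mapP[].
rewrite mem_cat !mem_cons L1E L2E K_path_cons // andbA step_p /=.
have [->|] := eqVneq q q1; first by rewrite (negPf neq_q) /= andbT andbF !orbF andbA.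
by have [->|] := eqVneq q q2; rewrite /= ?andbF ?andbT // andbA.
Qed.

(** * Evaluation in the three regions *)

(** The height and the number of remaining steps determine the point. With no
    steps left, a positive height means that x > 2n, so that the target is
    missed; at height 0 the point is the target itself. *)
Lemma counts_H2 (n X y : int) (k e : nat) :
  - y <= X -> 2 * X - y = e%:Z -> 3 * n - X - y = k%:Z ->
  counts (2 * n, 2 * n) (2 * X, y) (hwalks k e).
Proof.
elim: k e X y => [|k IHk] e X y region def_e def_k.
  case: e def_e => [|e] def_e /=; last by apply: counts_past => /=; lia.
  have [-> ->] : X = n /\ y = 2 * n by lia.
  exact: counts_target.
have -> : hwalks k.+1 e =
    (hwalks k e.+2 +
     (if (0 < e) then hwalks k e.-1 else 0))%N by case: e {def_e}.
apply: (@counts_step _ _ (2 * (X + 1), y) (2 * X, y + 1)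
  true (0 < e)%N (hwalks k e.+2) (hwalks k e.-1)) => /=.
- lia.
- by rewrite xpair_eqE; lia.
- by rewrite xpair_eqE; lia.
- move=> [x' y']; rewrite K_stepE /= ?xpair_eqE; last lia.
  by case: ifP => [|]; [|case: ifP]; lia.
- by move=> _; apply: IHk; lia.
- by move=> e_gt0; apply: IHk; lia.
Qed.

Lemma counts_normal (n d c : nat) (x y : int) :
  2 * x + y = c%:Z -> - (x + 2 * y) = d%:Z ->
  counts (2 * n%:Z, 2 * n%:Z) (x, y) (crossing (hwalks (3 * n)) d c).
Proof.
move: c x y; elim/ltn_ind: d => -[|d] IHd c x y def_c def_d.
  (* On the line x = -2y the abscissa is automatically even. *)
  have -> : x = 2 * (- y) by lia.
  by apply: counts_H2; lia.
have -> : crossing (hwalks (3 * n)) d.+1 c =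
    (crossing (hwalks (3 * n)) d c.+2 +
     (if (0 < d) then crossing (hwalks (3 * n)) d.-1 c.+1 else 0))%N.
  by case: d {IHd def_d}.
apply: (@counts_step _ _ (x + 1, y) (x, y + 1)
  true (0 < d)%N (crossing (hwalks (3 * n)) d c.+2)
  (crossing (hwalks (3 * n)) d.-1 c.+1)) => /=.
- lia.
- by rewrite xpair_eqE; lia.
- by rewrite xpair_eqE; lia.
- move=> [x' y']; rewrite K_stepE /= ?xpair_eqE; last lia.
  by case: ifP => [|]; [|case: ifP]; lia.
- by move=> _; apply: IHd; lia.
- by move=> d_gt0; apply: IHd; lia.
Qed.

(** For n >= 0 the walk counted by [vwalks] goes on past the line y = -2x, up to
    (2n, 2n), although the K-paths change their steps there: this is where
    [crossing_hwalks] enters. For n < 0 the target lies before that line, and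
    the path is a genuine V2-path. *)
Lemma counts_V2 (n x Y : int) (k e : nat) :
  x + Y <= 0 -> x - 2 * Y = e%:Z -> 3 * n - x - Y = k%:Z ->
  counts (2 * n, 2 * n) (x, 2 * Y) (vwalks k e).
Proof.
elim: k e x Y => [|k IHk] e x Y region def_e def_k.
  case: e def_e => [|e] def_e /=; last by apply: counts_past => /=; lia.
  have [-> ->] : x = 2 * n /\ Y = n by lia.
  exact: counts_target.
have [on_line | off_line] := eqVneq (x + Y) 0.
  (* There d = e = 3x and c = 0. *)
  have [N def_n] : exists N : nat, n = N%:Z by exists `|n|%N; lia.
  have -> : k.+1 = (3 * N)%N by lia.
  by rewrite def_n -crossing_hwalks; apply: counts_normal; lia.
have -> : vwalks k.+1 e =
    (vwalks k e.+1 +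
     (if (1 < e) then vwalks k e.-2 else 0))%N by case: e {def_e} => [|[]].
apply: (@counts_step _ _ (x + 1, 2 * Y) (x, 2 * (Y + 1))
  true (1 < e)%N (vwalks k e.+1) (vwalks k e.-2)) => /=.
- lia.
- by rewrite xpair_eqE; lia.
- by rewrite xpair_eqE; lia.
- move=> [x' y']; rewrite K_stepE /= ?xpair_eqE; last lia.
  by case: ifP => [|]; [|case: ifP]; lia.
- by move=> _; apply: IHk; lia.
- by move=> e_gt1; apply: IHk; lia.
Qed.

Lemma counts_card (t p : Z2) N : counts t p N ->
  finite_set (K_paths p t) /\ #|` fset_set (K_paths p t)|%fset = N.
Proof.
move=> [L [uL sL memL]].
pose L' := map (cons p) L.
have uL' : uniq L' by rewrite map_inj_uniq // => s s' [].
have -> : K_paths p t = [set` seq_fset tt L']%classic.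
  apply/seteqP; split=> P /=; rewrite (seq_fsetE tt L' P).
    move=> [s [-> last_s Ps]]; apply/mapP; exists s => //.
    by rewrite memL Ps last_s eqxx.
  by move=> /mapP[s]; rewrite memL => /andP[Ps /eqP last_s] ->; exists s.
split; first exact: finite_fset.
by rewrite set_fsetK (size_seq_fset tt) undup_id // size_map.
Qed.

Theorem theorem6p3 (m n : int) (hmn : 0 <= m + n) :
  let paths := K_paths (- (2 * m), - (2 * m)) (2 * n, 2 * n) in
  finite_set paths /\ (#|` fset_set paths|%fset)%:R = a `|(m + n)%R|%N.
Proof.
move=> paths; set k := `|(m + n)%R|%N.
have [|fin_paths ->] := @counts_card (2 * n, 2 * n)
    (- (2 * m), - (2 * m)) (hwalks (3 * k) 0).
  have [m_ge0 | m_lt0] := leP 0 m.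
    rewrite hwalks0_vwalks0 -{2}mulrN.
    by apply: counts_V2; lia.
  by rewrite -{1}mulrN; apply: counts_H2; lia.
split=> //; rewrite /a -hwalks_ternary_catalan addn1 natrM mulrC mulKf //.
by rewrite pnatr_eq0.
Qed.
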